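(* There exist collections $\mathcal C_1$ and $\mathcal C_2$ of languages over the universe $\mathbb Z$ such that $\mathcal C_1$ is non-uniformly generatable without samples (equivalently, generatable in the limit without samples), $\mathcal C_2$ is uniformly generatable without samples, but $\mathcal C_1 \cup \mathcal C_2$ is not generatable in the limit.
   Context: A language is an infinite subset of a countably infinite universe $U$ (here $U=\mathbb Z$); a collection is a (possibly uncountable) set of languages. An enumeration of a language $K$ is an infinite sequence $x_0, x_1, \dots$ of pairwise distinct elements of $K$ such that every element of $K$ appears in it; $S_t=\{x_0,\dots,x_t\}$. A generator algorithm is an arbitrary function $G$ from finite sequences of elements of $U$ to $U$; its output at time $t$ is $z_t=G(x_0,\dots,x_t)$. $G$ generates in the limit for $\mathcal C$ if for every $K\in\mathcal C$ and every enumeration $x$ of $K$ there is $t^\star$ such that $z_t\in K\setminus S_t$ for all $t\ge t^\star$; $\mathcal C$ is generatable in the limit if such a $G$ exists. A generator without samples is an injection $G:\mathbb N\to U$ (output $z_t=G(t)$). It uniformly generates without samples for $\mathcal C$ if there is $t^\star$ such that $z_t\in K$ for every $K\in\mathcal C$ and every $t\ge t^\star$; it generates in the limit without samples (equivalently, non-uniformly generates without samples) for $\mathcal C$ if for every $K\in\mathcal C$ there is $t^\star$ with $z_t\in K$ for all $t\ge t^\star$. *)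

(* Defs.v *)
From mathcomp Require Import all_boot all_order all_algebra.
From mathcomp Require Import boolp classical_sets functions cardinality.

Set Implicit Arguments.
Unset Strict Implicit.
Unset Printing Implicit Defensive.

Local Open Scope classical_set_scope.

Section Generation.
Variable U : Type.
Implicit Types (K : set U) (C : set (set U)) (x : nat -> U).

Definition is_language K : Prop := infinite_set K.

Definition is_collection C : Prop := forall K, C K -> is_language K.

Definition enumeration x K : Prop := injective x /\ range x = K.

Definition sample x (t : nat) : set U := [set x i | i in [set i | (i <= t)%N]].

Definition output (G : seq U -> U) x (t : nat) : U := G (mkseq x t.+1).

Definition generates_in_limit (G : seq U -> U) C : Prop :=
  forall K, C K -> forall x, enumeration x K ->
    exists tstar : nat, forall t : nat, (tstar <= t)%N ->
      (K `\` sample x t) (output G x t).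

Definition generatable_in_limit C : Prop :=
  exists G : seq U -> U, generates_in_limit G C.

Definition uniformly_generates_without_samples (G : nat -> U) C : Prop :=
  exists tstar : nat, forall K, C K ->
    forall t : nat, (tstar <= t)%N -> K (G t).

Definition uniformly_generatable_without_samples C : Prop :=
  exists G : nat -> U, injective G /\ uniformly_generates_without_samples G C.

(* Also called generation in the limit without samples: the threshold may
   depend on the language, and there is no enumeration for it to depend on. *)
Definition nonuniformly_generates_without_samples (G : nat -> U) C : Prop :=
  forall K, C K ->
    exists tstar : nat, forall t : nat, (tstar <= t)%N -> K (G t).

Definition nonuniformly_generatable_without_samples C : Prop :=
  exists G : nat -> U,
    injective G /\ nonuniformly_generates_without_samples G C.

End Generation.

(* Main.v *)
(* Let C1 collect the languages containing p m for all large m, and C2 those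
   containing every q k, where p and q are injective with disjoint ranges; then
   p and q themselves generate C1 and C2 without samples.  Against a generator
   G, show p 0, p 1, ... until G answers with some p m still to come; then show
   the next q k instead and skip p m forever.  If G is so caught infinitely
   often, the shown language lies in C2 although G errs each time.  Otherwise it
   lies in C1, and from some time on everything still to come is a p m, so that
   a correct answer would get G caught once more. *)
Require Import Defs.
From mathcomp Require Import all_boot all_order all_algebra.
From mathcomp Require Import boolp classical_sets functions cardinality.

Set Implicit Arguments.
Unset Strict Implicit.
Unset Printing Implicit Defensive.

Local Open Scope classical_set_scope.

Section Collections.
Variable U : Type.
Implicit Types p q : nat -> U.

Definition almost_containing p : set (set U) :=
  [set K | exists n, forall m, (n <= m)%N -> K (p m)].

Definition containing q : set (set U) := [set K | forall k, K (q k)].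

Lemma containing_sub_almost q : containing q `<=` almost_containing q.
Proof. by move=> K Kq; exists 0%N. Qed.

Lemma is_collection_almost_containing p :
  injective p -> is_collection (almost_containing p).
Proof.
move=> p_inj K [n Kp] K_fin; apply: infinite_nat.
have <- : (fun m => p (n + m)%N) @^-1` K = setT.
  by apply/seteqP; split=> // m _; apply: Kp; rewrite leq_addr.
by apply: finite_preimage => // i j _ _ /p_inj/addnI.
Qed.

Lemma is_collection_containing q :
  injective q -> is_collection (containing q).
Proof.
move=> /is_collection_almost_containing q_coll K Kq.
exact/q_coll/containing_sub_almost.
Qed.

Lemma almost_containing_generatable p :
  injective p -> nonuniformly_generatable_without_samples (almost_containing p).
Proof. by exists p; split. Qed.

Lemma containing_generatable q :
  injective q -> uniformly_generatable_without_samples (containing q).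
Proof. by exists q; split=> //; exists 0%N => K Kq t _; apply: Kq. Qed.

End Collections.

Section Adversary.
Variables (U : Type) (p q : nat -> U) (p_index : U -> option nat).
Hypothesis pK : pcancel p p_index.
Hypothesis p_index_q : forall k, p_index (q k) = None.
Hypothesis q_inj : injective q.
Variable G : seq U -> U.

Record position := Position { shown : seq U; next_p : nat; next_q : nat }.

Implicit Types (st : position) (i j k m n t T : nat).

Definition guess st : option nat := p_index (G (shown st)).

Definition caught st : bool := oapp (leq (next_p st)) false (guess st).

Definition response st : U :=
  if caught st then q (next_q st) else p (next_p st).

(* The maximum differs from [next_p st] only if [G] is caught, and then it is
   the index to be skipped. *)
Definition advance st : position :=
  Position (rcons (shown st) (response st))
           (maxn (next_p st) (odflt 0%N (guess st))).+1
           (caught st + next_q st).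

Definition play t : position := iter t advance (Position [::] 0 0).

Definition transcript t : U := response (play t).

Lemma shown_play t : shown (play t) = mkseq transcript t.
Proof. by elim: t => // t IHt; rewrite mkseqS /= IHt. Qed.

Lemma leq_next_p : {mono (fun t => next_p (play t)) : i j / (i <= j)%N}.
Proof.
by apply: leq_mono; apply: homo_ltn ltn_trans _ => t; rewrite ltnS leq_maxl.
Qed.

Lemma next_q_homo :
  {homo (fun t => next_q (play t)) : i j / (i <= j)%N}.
Proof. by apply: homo_leq leq_trans _ => // t; apply: leq_addl. Qed.

Lemma ltn_next_q_caught i j :
  caught (play i) -> (i < j)%N -> (next_q (play i) < next_q (play j))%N.
Proof. by move=> ci /next_q_homo; rewrite /= ci. Qed.

Lemma p_index_transcript t :
  p_index (transcript t) =
    if caught (play t) then None else Some (next_p (play t)).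
Proof. by rewrite /transcript /response; case: ifP. Qed.

Lemma transcript_inj : injective transcript.
Proof.
move=> i j; wlog ij : i j / (i <= j)%N.
  by move=> inj_le; case/orP: (leq_total i j) => /inj_le // ji /esym/ji.
move=> xij; have := congr1 p_index xij; rewrite !p_index_transcript.
case: ifP => ci; case: ifP => cj // np_eq; last first.
  by apply: (incn_inj leq_next_p); case: np_eq.
move: xij; rewrite /transcript /response ci cj => /q_inj nq_eq.
apply/eqP; case: ltngtP ij => // /(ltn_next_q_caught ci).
by rewrite nq_eq ltnn.
Qed.

Lemma caught_never_shown t :
  caught (play t) -> ~ range transcript (G (mkseq transcript t)).
Proof.
rewrite -shown_play => ct [i _ /(congr1 p_index)].
rewrite p_index_transcript -/(guess _); case: ifPn => ci guess_t.
  by move: ct; rewrite /caught -guess_t.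
have t_le_i : (t <= i)%N.
  by move: ct; rewrite /caught -guess_t /= leq_next_p.
have : (t < i)%N.
  by rewrite ltn_neqAle t_le_i andbT; apply: contraNneq ci => <-.
by rewrite -leq_next_p /= -guess_t /= leqNgt ltnS leq_maxr.
Qed.

Lemma caught_guessing_unshown t i :
  (t <= i)%N -> ~~ caught (play i) ->
  transcript i = G (mkseq transcript t) -> caught (play t).
Proof.
move=> ti /negPf ci; rewrite -shown_play => /(congr1 p_index).
by rewrite p_index_transcript ci /caught /guess => <-; rewrite /= leq_next_p.
Qed.

Lemma next_p_advance_uncaught st :
  ~~ caught st -> next_p (advance st) = (next_p st).+1.
Proof.
rewrite /caught /=; case: (guess st) => [m|] /=; last by rewrite maxn0.
by rewrite -ltnNge => /ltnW/maxn_idPl->.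
Qed.

Lemma transcript_uncaught T :
  (forall t, (T <= t)%N -> ~~ caught (play t)) ->
  forall d, transcript (T + d) = p (next_p (play T) + d).
Proof.
move=> uncaught d; rewrite /transcript /response ifN ?uncaught ?leq_addr //.
congr p; elim: d => [|d IHd]; first by rewrite !addn0.
by rewrite !addnS [play _]/= next_p_advance_uncaught ?IHd ?uncaught ?leq_addr.
Qed.

Lemma uncaught_almost_containing T :
  (forall t, (T <= t)%N -> ~~ caught (play t)) ->
  almost_containing p (range transcript).
Proof.
move=> uncaught; exists (next_p (play T)) => m /subnKC <-.
by rewrite -transcript_uncaught //; exists (T + (m - next_p (play T)))%N.
Qed.

Lemma range_transcript_q t k :
  (k < next_q (play t))%N -> range transcript (q k).
Proof.
elim: t => // t IHt /=; case: (boolP (caught _)) => ct //=.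
rewrite ltnS leq_eqVlt => /predU1P[->|//].
by exists t; rewrite // /transcript /response ct.
Qed.

Lemma caught_often_containing :
  (forall T, exists2 t, (T <= t)%N & caught (play t)) ->
  containing q (range transcript).
Proof.
move=> often k.
suff [t] : exists t, (k < next_q (play t))%N by apply: range_transcript_q.
elim: k => [|k [t kt]]; first have [t _ ct] := often 0%N.
  by exists t.+1; rewrite /= ct.
have [t' tt' ct'] := often t; exists t'.+1.
by rewrite /= ct' ltnS (leq_trans kt) // next_q_homo.
Qed.

Lemma not_generates_union :
  ~ generates_in_limit G (almost_containing p `|` containing q).
Proof.
move=> G_gen.
have transcript_enum := conj transcript_inj (erefl (range transcript)).
have [[T uncaught]|often] :=
  pselect (exists T, forall t, (T <= t)%N -> ~~ caught (play t)).
- have [T' G_right] :=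
    G_gen _ (or_introl (uncaught_almost_containing uncaught)) _ transcript_enum.
  have [[i _ guess_i] not_shown] := G_right _ (leq_maxl T' T).
  have late_i : (maxn T' T < i)%N.
    by rewrite ltnNge; apply/negP => i_le; apply: not_shown; exists i.
  have T_le_i : (T <= i)%N by rewrite (leq_trans _ (ltnW late_i)) ?leq_maxr.
  have := caught_guessing_unshown late_i (uncaught i T_le_i) guess_i.
  by apply/negP/uncaught; rewrite leqW ?leq_maxr.
- have {}often T : exists2 t, (T <= t)%N & caught (play t).
    apply: contrapT => never; apply: often; exists T => t Tt.
    by apply/negP => ct; apply: never; exists t.
  have [T G_right] :=
    G_gen _ (or_intror (caught_often_containing often)) _ transcript_enum.
  have [[//|t] Tt /caught_never_shown] := often T.+1.
  by have [] := G_right t Tt.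
Qed.

End Adversary.

Lemma not_generatable_union (U : Type) (p q : nat -> U) :
  injective p -> injective q -> (forall m k, p m <> q k) ->
  ~ generatable_in_limit (almost_containing p `|` containing q).
Proof.
move=> p_inj q_inj p_neq_q.
have /choice[p_index p_indexP] z :
    exists o, if o is Some m then p m = z else forall m, p m <> z.
  have [[m pm]|no_index] := pselect (exists m, p m = z).
    by exists (Some m).
  by exists None => m pm; apply: no_index; exists m.
have pK : pcancel p p_index.
  by move=> m; have := p_indexP (p m); case: (p_index _) => [n /p_inj->|/(_ m)].
have p_index_q k : p_index (q k) = None.
  by have := p_indexP (q k); case: (p_index _) => // m /p_neq_q.
by case=> G; apply: not_generates_union pK p_index_q q_inj G.
Qed.

Theorem theorem1p1 :
  exists C1 C2 : set (set int),
    is_collection C1 /\ is_collection C2 /\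
    nonuniformly_generatable_without_samples C1 /\
    uniformly_generatable_without_samples C2 /\
    ~ generatable_in_limit (C1 `|` C2).
Proof.
have Posz_inj : injective Posz by move=> i j [].
have Negz_inj : injective Negz by move=> i j [].
exists (almost_containing Posz), (containing Negz).
split; last split; last split; last split.
- exact: is_collection_almost_containing.
- exact: is_collection_containing.
- exact: almost_containing_generatable.
- exact: containing_generatable.
- exact: not_generatable_union.
Qed.
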